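(* Let $(M,G=g+F)$ be a generalized Riemannian manifold, let $A$ be the $(1,1)$-tensor with $F(X,Y)=g(AX,Y)$, let $N$ be the Nijenhuis tensor of $A$, and let $\nabla^g$ be the Levi-Civita connection of $g$. If there exists a linear connection $\nabla$ preserving $G$, $\nabla G=0$, with totally skew-symmetric torsion $T$, then $$N(X,Y,AZ)+N(X,Z,AY)=dF(X,Y,A^2Z)+dF(X,Z,A^2Y).$$ The torsion tensor satisfies $$T(AX,AY,Z)=-N(X,Y,Z)+dF(X,Y,AZ),\qquad T(AX,Y,Z)=2(\nabla^g_XF)(Y,Z)-dF(X,Y,Z),$$ and the connection $\nabla$ is determined by $$g(\nabla_XY,Z)=g(\nabla^g_XY,Z)+\tfrac12T(X,Y,Z).$$ If in addition $dF=0$, then these equalities hold with $dF=0$ inserted, that is, $N(X,Y,AZ)+N(X,Z,AY)=0$, $T(AX,AY,Z)=-N(X,Y,Z)$ and $T(AX,Y,Z)=2(\nabla^g_XF)(Y,Z)$.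
   Context: A generalized (non-symmetric) Riemannian manifold $(M,G)$ is a smooth manifold with a smooth $(0,2)$-tensor $G=g+F$, where $g(X,Y)=\frac12(G(X,Y)+G(Y,X))$ is the symmetric part, assumed non-degenerate (of arbitrary signature), and $F(X,Y)=\frac12(G(X,Y)-G(Y,X))$ is the skew-symmetric part. The $(1,1)$-tensor $A$ is defined by $F(X,Y)=g(AX,Y)$. The torsion of $\nabla$ is $T(X,Y)=\nabla_XY-\nabla_YX-[X,Y]$, with $(0,3)$-version $T(X,Y,Z)=g(T(X,Y),Z)$; it is totally skew-symmetric if $T(X,Y,Z)=-T(X,Z,Y)$. The Nijenhuis tensor of $A$ is $N(X,Y)=[AX,AY]+A^2[X,Y]-A[AX,Y]-A[X,AY]$, with $N(X,Y,Z)=g(N(X,Y),Z)$. The exterior derivative is normalized so that for commuting vector fields $dF(X,Y,Z)=XF(Y,Z)+YF(Z,X)+ZF(X,Y)$. Tensor identities hold for all vector fields $X,Y,Z$. *)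

(* Defs.v *)
From HB Require Import structures.
From mathcomp Require Import all_boot all_order all_algebra.
From mathcomp Require Import all_classical all_reals all_analysis.
From mathcomp Require Import ring.
Set Implicit Arguments.
Unset Strict Implicit.
Unset Printing Implicit Defensive.
Import Order.TTheory GRing.Theory Num.Theory.
Import numFieldNormedType.Exports.
Local Open Scope classical_set_scope.
Local Open Scope ring_scope.

Fixpoint Ck_on (R : realType) (n k : nat) (U : set 'rV[R]_n)
    (f : 'rV[R]_n -> R) : Prop :=
  (forall x, U x -> {for x, continuous f}) /\
  (if k is k'.+1 then
     forall i : 'I_n, (forall x, U x -> derivable f x (delta_mx 0 i)) /\
                      Ck_on k' U ('D_(delta_mx 0 i) f)
   else True).

Definition smooth_on (R : realType) (n : nat) (U : set 'rV[R]_n)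
    (f : 'rV[R]_n -> R) : Prop := forall k, Ck_on k U f.

(* Both maps of a chart are total; their values outside [chart_dom] and
   [chart_map @` chart_dom] are irrelevant. *)
Record chart (R : realType) (n : nat) (M : topologicalType) := Chart {
  chart_dom : set M;
  chart_map :> M -> 'rV[R]_n;
  chart_inv : 'rV[R]_n -> M;
  chart_dom_open : open chart_dom;
  chart_img_open : open (chart_map @` chart_dom);
  chart_mapK : forall p, chart_dom p -> chart_inv (chart_map p) = p;
  chart_map_cont : forall p, chart_dom p -> {for p, continuous chart_map};
  chart_inv_cont : forall x, (chart_map @` chart_dom) x ->
                     {for x, continuous chart_inv} }.

Definition chart_img (R : realType) (n : nat) (M : topologicalType)
  (c : chart R n M) : set 'rV[R]_n := c @` chart_dom c.

Definition smooth_transition (R : realType) (n : nat) (M : topologicalType)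
    (c d : chart R n M) : Prop :=
  forall j : 'I_n,
    smooth_on (c @` (chart_dom c `&` chart_dom d))
              (fun x => d (chart_inv c x) 0 j).

(* The atlas need not be maximal: an atlas and the maximal atlas containing it
   give the same smooth functions. *)
Record manifold (R : realType) (n : nat) := Manifold {
  manifold_sort :> topologicalType;
  manifold_hausdorff : hausdorff_space manifold_sort;
  manifold_second_countable : @second_countable manifold_sort;
  atlas : set (chart R n manifold_sort);
  atlas_cover : forall p, exists2 c, atlas c & chart_dom c p;
  atlas_smooth : forall c d, atlas c -> atlas d -> smooth_transition c d }.

Definition is_smooth (R : realType) (n : nat) (M : manifold R n)
    (f : M -> R) : Prop :=
  forall c, atlas c -> smooth_on (chart_img c) (f \o chart_inv c).

Section SmoothClosure.
Context (R : realType) (n : nat).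
Implicit Types (U : set 'rV[R]_n) (f g : 'rV[R]_n -> R).

Lemma near_eq_on U f g : open U -> (forall x, U x -> f x = g x) ->
  forall x, U x -> {near x, f =1 g}.
Proof.
move=> oU fg x Ux; have : nbhs x U by exact: open_nbhs_nbhs.
by apply: filterS => y; exact: fg.
Qed.

Lemma continuous_eq_on U f g : open U -> (forall x, U x -> f x = g x) ->
  (forall x, U x -> {for x, continuous f}) ->
  forall x, U x -> {for x, continuous g}.
Proof.
move=> oU fg cf x Ux; have := cf x Ux; rewrite /prop_for /continuous_at -fg//.
apply: cvg_trans.
exact: (@near_eq_cvg _ _ (nbhs x) _ _ _ (near_eq_on oU fg Ux)).
Qed.

Lemma Ck_on_eq k U f g : open U -> (forall x, U x -> f x = g x) ->
  Ck_on k U f -> Ck_on k U g.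
Proof.
move=> oU; elim: k f g => [|k IH] f g fg [cf df].
  by split=> //; exact: continuous_eq_on cf.
split; first exact: continuous_eq_on cf.
move=> i; have [dfi Cfi] := df i; split=> [x Ux|].
  by apply: (near_eq_derivable (near_eq_on oU fg Ux)); exact: dfi.
apply: IH Cfi => x Ux; apply: near_eq_derive.
by apply: filterS (near_eq_on oU fg Ux) => y.
Qed.

Lemma Ck_onW k U f : Ck_on k.+1 U f -> Ck_on k U f.
Proof.
elim: k f => [|k IH] f [cf df]; first by split.
by split=> // i; have [dfi Cfi] := df i; split=> //; exact: IH.
Qed.

Lemma Ck_on_cst k U (a : R) : Ck_on k U (cst a).
Proof.
elim: k a => [|k IH] a; first by split=> // x _; exact: cst_continuous.
split=> [x _|i]; first exact: cst_continuous.
split; first by move=> x _; exact: derivable_cst.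
rewrite (_ : 'D_(delta_mx 0 i) (cst a) = cst 0); first exact: IH.
by apply/funext => x; rewrite derive_cst.
Qed.

Lemma Ck_onD k U f g : open U -> Ck_on k U f -> Ck_on k U g ->
  Ck_on k U (f + g).
Proof.
move=> oU; elim: k f g => [|k IH] f g [cf df] [cg dg].
  by split=> // x Ux; apply: continuousD; [exact: cf|exact: cg].
split=> [x Ux|i]; first by apply: continuousD; [exact: cf|exact: cg].
have [dfi Cfi] := df i; have [dgi Cgi] := dg i; split=> [x Ux|].
  by apply: derivableD; [exact: dfi|exact: dgi].
apply: (Ck_on_eq oU _ (IH _ _ Cfi Cgi)) => x Ux.
by rewrite deriveD//; [exact: dfi|exact: dgi].
Qed.

Lemma Ck_onM k U f g : open U -> Ck_on k U f -> Ck_on k U g ->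
  Ck_on k U (f * g).
Proof.
move=> oU; elim: k f g => [|k IH] f g Cf Cg.
  case: Cf Cg => [cf _] [cg _].
  by split=> // x Ux; apply: continuousM; [exact: cf|exact: cg].
have [[cf df] [cg dg]] := (Cf, Cg).
split=> [x Ux|i]; first by apply: continuousM; [exact: cf|exact: cg].
have [dfi Cfi] := df i; have [dgi Cgi] := dg i; split=> [x Ux|].
  by apply: derivableM; [exact: dfi|exact: dgi].
apply: (Ck_on_eq oU _ (Ck_onD oU (IH _ _ (Ck_onW Cf) Cgi)
                                 (IH _ _ (Ck_onW Cg) Cfi))) => x Ux.
by rewrite deriveM//; [exact: dfi|exact: dgi].
Qed.

End SmoothClosure.

Section SmoothAlgebra.
Context (R : realType) (n : nat) (M : manifold R n).

Definition smooth_pred : {pred (M -> R)} := mem [set f | is_smooth f].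

Lemma smooth_predP f : reflect (is_smooth f) (f \in smooth_pred).
Proof. by apply: (iffP idP); rewrite inE. Qed.

Lemma smooth_cst (a : R) : (cst a : M -> R) \in smooth_pred.
Proof. by apply/smooth_predP => c _ k; exact: (Ck_on_cst _ _ a). Qed.

Lemma smooth_add (f g : M -> R) : f \in smooth_pred -> g \in smooth_pred ->
  f + g \in smooth_pred.
Proof.
move=> /smooth_predP sf /smooth_predP sg; apply/smooth_predP => c Mc k.
by apply: Ck_onD; [exact: chart_img_open|exact: sf|exact: sg].
Qed.

Lemma smooth_mul (f g : M -> R) : f \in smooth_pred -> g \in smooth_pred ->
  f * g \in smooth_pred.
Proof.
move=> /smooth_predP sf /smooth_predP sg; apply/smooth_predP => c Mc k.
by apply: Ck_onM; [exact: chart_img_open|exact: sf|exact: sg].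
Qed.

Lemma smooth_scale (a : R) (f : M -> R) : f \in smooth_pred ->
  a *: f \in smooth_pred.
Proof. by move=> sf; exact: (smooth_mul (smooth_cst a) sf). Qed.

Lemma smooth_subring : subring_closed smooth_pred.
Proof.
split=> [|f g sf sg|]; [exact: (smooth_cst 1)| |exact: smooth_mul].
by apply: smooth_add => //; rewrite -scaleN1r; exact: smooth_scale.
Qed.

Lemma smooth_submod : submod_closed smooth_pred.
Proof.
split=> [|a f g sf sg]; first exact: (smooth_cst 0).
by apply: smooth_add => //; exact: smooth_scale.
Qed.

HB.instance Definition _ :=
  GRing.isSubringClosed.Build (M -> R) smooth_pred smooth_subring.
HB.instance Definition _ :=
  GRing.isSubmodClosed.Build R (M -> R) smooth_pred smooth_submod.

Record smooth_fun := SmoothFun {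
  smooth_val :> M -> R;
  smooth_valP : smooth_val \in smooth_pred }.

HB.instance Definition _ := [isSub for smooth_val].
HB.instance Definition _ := gen_eqMixin smooth_fun.
HB.instance Definition _ := gen_choiceMixin smooth_fun.
HB.instance Definition _ :=
  GRing.SubChoice_isSubComPzRing.Build (M -> R) smooth_pred smooth_fun
    smooth_subring.
HB.instance Definition _ := [SubZmodule_isSubLmodule of smooth_fun by <:].

End SmoothAlgebra.

Arguments smooth_fun {R n} M.

(* Smooth vector fields, as R-derivations of the algebra of smooth functions;
   the tangent vector X_p is [f |-> X f p]. *)
Record vector_field (R : realType) (n : nat) (M : manifold R n) := VectorField {
  vf_map :> smooth_fun M -> smooth_fun M;
  vf_linear : linear vf_map;
  vf_leibniz : forall f g, vf_map (f * g) = f * vf_map g + g * vf_map f }.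

Arguments vector_field {R n} M.

Section VectorFields.
Context (R : realType) (n : nat) (M : manifold R n).
Implicit Types (X Y Z : vector_field M) (f g h : smooth_fun M).

Lemma scale_smoothAl (a : R) f g : a *: (f * g) = (a *: f) * g.
Proof. by apply/val_inj/funext => p; exact: mulrA. Qed.

Lemma scale_smoothAr (a : R) f g : a *: (f * g) = f * (a *: g).
Proof. by rewrite mulrC scale_smoothAl mulrC. Qed.

Lemma vf_ext X Y : X =1 Y -> X = Y.
Proof.
case: X Y => [X lX dX] [Y lY dY] /= /funext XY; rewrite XY in lX dX *.
by congr VectorField; exact: Prop_irrelevance.
Qed.

Lemma vfD X f g : X (f + g) = X f + X g.
Proof. by have := vf_linear X 1 f g; rewrite !scale1r. Qed.

Lemma vf0 X : X 0 = 0.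
Proof. by apply: (addrI (X 0)); rewrite -vfD !addr0. Qed.

Lemma vfZ X (a : R) f : X (a *: f) = a *: X f.
Proof. by have := vf_linear X a f 0; rewrite !addr0 vf0 addr0. Qed.

Lemma vfN X f : X (- f) = - X f.
Proof. by rewrite -scaleN1r vfZ scaleN1r. Qed.

Lemma vfB X f g : X (f - g) = X f - X g.
Proof. by rewrite vfD vfN. Qed.

Program Definition vf_zero : vector_field M := @VectorField R n M (fun=> 0) _ _.
Next Obligation. by move=> a f g /=; rewrite scaler0 addr0. Qed.
Next Obligation. by move=> f g /=; rewrite !mulr0 addr0. Qed.

Program Definition vf_add X Y : vector_field M :=
  @VectorField R n M (fun f => X f + Y f) _ _.
Next Obligation.
by move=> X Y a f g /=; rewrite !vfD !vfZ scalerDr addrACA.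
Qed.
Next Obligation.
by move=> X Y f g /=; rewrite !vf_leibniz !mulrDr addrACA.
Qed.

Program Definition vf_scale (h : smooth_fun M) X : vector_field M :=
  @VectorField R n M (fun f => h * X f) _ _.
Next Obligation.
by move=> h X a f g /=; rewrite vfD vfZ mulrDr scale_smoothAr.
Qed.
Next Obligation.
by move=> h X f g /=; rewrite vf_leibniz mulrDr !mulrA (mulrC h f) (mulrC h g).
Qed.

Definition vf_opp X : vector_field M := vf_scale (- 1) X.

Fact vf_addA : associative vf_add.
Proof. by move=> X Y Z; apply: vf_ext => f; exact: addrA. Qed.
Fact vf_addC : commutative vf_add.
Proof. by move=> X Y; apply: vf_ext => f; exact: addrC. Qed.
Fact vf_add0 : left_id vf_zero vf_add.
Proof. by move=> X; apply: vf_ext => f; exact: add0r. Qed.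
Fact vf_addN : left_inverse vf_zero vf_opp vf_add.
Proof. by move=> X; apply: vf_ext => f /=; rewrite mulN1r addNr. Qed.

HB.instance Definition _ := gen_eqMixin (vector_field M).
HB.instance Definition _ := gen_choiceMixin (vector_field M).
HB.instance Definition _ := GRing.isZmodule.Build (vector_field M)
  vf_addA vf_addC vf_add0 vf_addN.

Fact vf_scaleA f g X : vf_scale f (vf_scale g X) = vf_scale (f * g) X.
Proof. by apply: vf_ext => h; exact: mulrA. Qed.
Fact vf_scale1 : left_id 1 vf_scale.
Proof. by move=> X; apply: vf_ext => h; exact: mul1r. Qed.
Fact vf_scaleDr : right_distributive vf_scale +%R.
Proof. by move=> f X Y; apply: vf_ext => h; exact: mulrDr. Qed.
Fact vf_scaleDl X : {morph vf_scale ^~ X : f g / f + g}.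
Proof. by move=> f g; apply: vf_ext => h; exact: mulrDl. Qed.

HB.instance Definition _ :=
  GRing.Zmodule_isLmodule.Build (smooth_fun M) (vector_field M)
    vf_scaleA vf_scale1 vf_scaleDr vf_scaleDl.

Program Definition lie X Y : vector_field M :=
  @VectorField R n M (fun f => X (Y f) - Y (X f)) _ _.
Next Obligation.
move=> X Y a f g /=; rewrite !(vfD, vfZ) scalerBr opprD; apply: addrACA.
Qed.
Next Obligation.
move=> X Y f g /=; rewrite !(vf_leibniz, vfD) !mulrBr.
ring.
Qed.

End VectorFields.

Section Tensors.
Context (R : realType) (n : nat) (M : manifold R n).
Local Notation C := (smooth_fun M).
Local Notation V := (vector_field M).

(* Tensor fields are maps on vector fields that are linear over the ring of
   smooth functions in each argument. *)
Definition is_tensor02 (G : V -> V -> C) : Prop :=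
  (forall Y, scalar (G ^~ Y)) /\ (forall X, scalar (G X)).

Definition is_tensor11 (A : V -> V) : Prop := linear A.

(* Pointwise: X_p is zero as soon as it is orthogonal to every tangent vector
   at p, each of which is the value at p of a global vector field. *)
Definition nondegenerate02 (g : V -> V -> C) : Prop :=
  forall (X : V) (p : M), (forall Y, g X Y p = 0) -> forall f : C, X f p = 0.

Definition sym_part (G : V -> V -> C) (X Y : V) : C :=
  (2^-1 : R) *: (G X Y + G Y X).

Definition skew_part (G : V -> V -> C) (X Y : V) : C :=
  (2^-1 : R) *: (G X Y - G Y X).

(* R-linearity in Y follows: the Leibniz rule applied to a constant function. *)
Definition is_connection (D : V -> V -> V) : Prop :=
  [/\ forall Y, linear (D ^~ Y),
      forall X Y Z, D X (Y + Z) = D X Y + D X Z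
    & forall X (f : C) Y, D X (f *: Y) = X f *: Y + f *: D X Y].

(* [cov_deriv02 D G X Y Z] is (D_X G)(Y, Z). *)
Definition cov_deriv02 (D : V -> V -> V) (G : V -> V -> C) (X Y Z : V) : C :=
  X (G Y Z) - G (D X Y) Z - G Y (D X Z).

Definition parallel02 (D : V -> V -> V) (G : V -> V -> C) : Prop :=
  forall X Y Z, cov_deriv02 D G X Y Z = 0.

Definition torsion (D : V -> V -> V) (X Y : V) : V := D X Y - D Y X - lie X Y.

Definition lower (g : V -> V -> C) (S : V -> V -> V) (X Y Z : V) : C :=
  g (S X Y) Z.

Definition totally_skew_torsion (g : V -> V -> C) (D : V -> V -> V) : Prop :=
  forall X Y Z,
    lower g (torsion D) X Y Z = - lower g (torsion D) X Z Y.

Definition is_levi_civita (g : V -> V -> C) (D : V -> V -> V) : Prop :=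
  [/\ is_connection D, parallel02 D g & forall X Y, torsion D X Y = 0].

Definition nijenhuis (A : V -> V) (X Y : V) : V :=
  lie (A X) (A Y) + A (A (lie X Y)) - A (lie (A X) Y) - A (lie X (A Y)).

Definition ext_deriv2 (F : V -> V -> C) (X Y Z : V) : C :=
  X (F Y Z) + Y (F Z X) + Z (F X Y)
  - F (lie X Y) Z - F (lie Y Z) X - F (lie Z X) Y.

End Tensors.

(* Main.v *)
Require Import Defs.
From mathcomp Require Import all_boot all_order all_algebra.
From mathcomp Require Import all_classical all_reals all_analysis.
From mathcomp Require Import ring.
Set Implicit Arguments.
Unset Strict Implicit.
Unset Printing Implicit Defensive.
Import GRing.Theory.
Local Open Scope ring_scope.

(** The proof is an algebraic computation in the module of vector fields over
    the ring of smooth functions; no coordinates are used. The key point is that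
    every quantity of the theorem is a combination of values of the 3-form T.

    Splitting [D G = 0] into its symmetric and skew parts gives [D g = 0] and
    [D F = 0] ([parallel_sym_part], [parallel_skew_part]), and then [D A = 0]
    because g is non-degenerate ([parallel_endo]). Since T is a 3-form, the
    argument that proves uniqueness of the Levi-Civita connection shows that D
    differs from it by T / 2 ([skew_torsion_contorsion]). Once brackets are
    replaced by [D X Y - D Y X - torsion D X Y], all derivatives cancel, and the
    skew-adjointness of A turns what is left into

      dF(X,Y,Z)        = - T(AX,Y,Z) - T(X,AY,Z) - T(X,Y,AZ),
      2 (Dg_X F)(Y,Z)  = - T(X,AY,Z) - T(X,Y,AZ),
      N(X,Y,Z)         = - T(AX,AY,Z) - T(AX,Y,AZ) - T(X,AY,AZ) - T(X,Y,AAZ)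

    ([ext_deriv2_torsion], [levi_civita_deriv_torsion], [nijenhuis_torsion]).
    The two formulas for T follow by subtraction. The condition on N and dF says
    that T(AX,AY,AZ), as computed from the first of them, is skew in Y and Z. *)

(** * Torsion, and bilinear forms on vector fields *)

Section Bilinear.
Context (R : realType) (n : nat) (M : manifold R n).
Local Notation C := (smooth_fun M).
Local Notation V := (vector_field M).
Implicit Types (G : V -> V -> C) (D : V -> V -> V) (X Y Z : V) (f : C).

Lemma half_double f : (2^-1 : R) *: (f *+ 2) = f.
Proof. by rewrite -scalerMnr scalerMnl -mulr_natr mulVf ?scale1r. Qed.

Lemma lieC X Y : lie X Y = - lie Y X.
Proof. by apply: vf_ext => f /=; rewrite mulN1r opprB. Qed.

Lemma torsionC D X Y : torsion D X Y = - torsion D Y X.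
Proof. by rewrite /torsion (lieC X Y) opprK !opprB addrC. Qed.

Section TensorAdditivity.
Context (G : V -> V -> C) (tG : is_tensor02 G).

Lemma tensor02Dl X Y Z : G (X + Y) Z = G X Z + G Y Z.
Proof. by have := tG.1 Z 1 X Y; rewrite scale1r mul1r. Qed.

Lemma tensor02Nl X Z : G (- X) Z = - G X Z.
Proof.
have := tG.1 Z (-1) X X; rewrite scaleN1r addNr mulN1r addNr => G0.
by apply: (addIr (G X Z)); rewrite -tensor02Dl !addNr.
Qed.

Definition tensor02El := (tensor02Dl, tensor02Nl).

End TensorAdditivity.

Lemma sym_part_tensor G : is_tensor02 G -> is_tensor02 (sym_part G).
Proof.
move=> [tl tr]; split=> [Y f X Z|Y f X Z]; rewrite /sym_part tl tr;
  rewrite -scale_smoothAr -scalerDr mulrDr; congr (_ *: _); exact: addrACA.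
Qed.

Lemma sym_partC G X Y : sym_part G X Y = sym_part G Y X.
Proof. by rewrite /sym_part addrC. Qed.

Lemma skew_partC G X Y : skew_part G X Y = - skew_part G Y X.
Proof. by rewrite /skew_part -scalerN opprB. Qed.

(** Covariant differentiation is R-linear in the form and commutes with the
    exchange of its two arguments, hence with taking symmetric and skew parts. *)
Lemma parallel_sym_part D G : parallel02 D G -> parallel02 D (sym_part G).
Proof.
move=> pG X Y Z; rewrite /cov_deriv02 /sym_part vfZ -!scalerBr vfD.
rewrite [X in _ *: X](_ : _ = cov_deriv02 D G X Y Z + cov_deriv02 D G X Z Y).
  by rewrite !pG addr0 scaler0.
by rewrite /cov_deriv02; ring.
Qed.

Lemma parallel_skew_part D G : parallel02 D G -> parallel02 D (skew_part G).
Proof.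
move=> pG X Y Z; rewrite /cov_deriv02 /skew_part vfZ -!scalerBr vfB.
rewrite [X in _ *: X](_ : _ = cov_deriv02 D G X Y Z - cov_deriv02 D G X Z Y).
  by rewrite !pG subr0 scaler0.
by rewrite /cov_deriv02; ring.
Qed.

Lemma parallel02E D G X Y Z : parallel02 D G ->
  X (G Y Z) = G (D X Y) Z + G Y (D X Z).
Proof. by move=> /(_ X Y Z) /eqP; rewrite /cov_deriv02 !subr_eq add0r addrC => /eqP. Qed.

Lemma nondegenerate02_inj G X Y : is_tensor02 G -> nondegenerate02 G ->
  (forall Z, G X Z = G Y Z) -> X = Y.
Proof.
move=> tG nG eqXY; apply/eqP; rewrite -subr_eq0; apply/eqP/vf_ext => f.
apply/val_inj/funext => p; apply: nG => Z.
by rewrite (tensor02Dl tG) (tensor02Nl tG) eqXY subrr.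
Qed.

End Bilinear.

(** * Metric connections with totally skew-symmetric torsion *)

Section SkewTorsion.
Context (R : realType) (n : nat) (M : manifold R n).
Local Notation C := (smooth_fun M).
Local Notation V := (vector_field M).
Context (g : V -> V -> C) (D Dg : V -> V -> V).
Context (tg : is_tensor02 g) (gC : forall X Y, g X Y = g Y X).
Context (pg : parallel02 D g) (skewT : totally_skew_torsion g D).
Local Notation T := (lower g (torsion D)).

Lemma torsion_skew12 X Y Z : T X Y Z = - T Y X Z.
Proof. by rewrite /lower torsionC (tensor02Nl tg). Qed.

Lemma torsion_cycle X Y Z : T X Y Z = T Y Z X.
Proof. by rewrite torsion_skew12 (skewT Y X Z) opprK. Qed.

(** Metricity of both connections makes their difference K skew in the last two
    arguments, and the first two arguments of K are exchanged at the cost of T.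
    Alternating three exchanges of each kind gives [K = T - K]. *)
Lemma skew_torsion_contorsion X Y Z : is_levi_civita g Dg ->
  g (D X Y) Z = g (Dg X Y) Z + (2^-1 : R) *: T X Y Z.
Proof.
move=> [_ pDg symDg]; pose K X Y Z := g (D X Y) Z - g (Dg X Y) Z.
have Kskew U W S : K U W S = - K U S W.
  have := parallel02E U W S pg; rewrite (parallel02E _ _ _ pDg).
  rewrite (gC W (D U S)) (gC W (Dg U S)) /K => /eqP.
  rewrite -subr_eq0 => /eqP e; apply/eqP; rewrite -subr_eq0 -oppr_eq0 -e.
  by apply/eqP; ring.
have Kswap U W S : K U W S = K W U S + T U W S.
  have := symDg U W => /(congr1 (g ^~ S)).
  rewrite /K /lower /torsion !(tensor02El tg).
  have -> : g 0 S = 0 by rewrite -(subrr U) !(tensor02El tg) subrr.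
  move=> /eqP; rewrite subr_eq0 => /eqP <-; ring.
have K2 : K X Y Z *+ 2 = T X Y Z.
  rewrite mulr2n {1}Kswap Kskew Kswap Kskew Kswap Kskew.
  rewrite -(torsion_cycle X Y Z) (torsion_cycle Z X Y); ring.
by rewrite -K2 half_double /K subrKC.
Qed.

(** * Parallel skew-adjoint endomorphisms *)

Context (F : V -> V -> C) (A : V -> V).
Context (FC : forall X Y, F X Y = - F Y X) (FA : forall X Y, F X Y = g (A X) Y).
Context (pF : parallel02 D F).

Lemma endo_skew_adjoint X Y : g (A X) Y = - g X (A Y).
Proof. by rewrite -FA FC FA gC. Qed.

(** In the sum of the derivatives of F in the cyclic directions, the terms in
    [D] combine with the brackets into torsions, contracted with F. *)
Lemma ext_deriv2_torsion X Y Z :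
  ext_deriv2 F X Y Z = - T (A X) Y Z - T X (A Y) Z - T X Y (A Z).
Proof.
have Flie U W S : F (lie U W) S = F (D U W) S - F (D W U) S + T U W (A S).
  by rewrite /lower /torsion !FA !endo_skew_adjoint !(tensor02El tg); ring.
rewrite /ext_deriv2 !Flie !(parallel02E _ _ _ pF).
rewrite (FC Y) (FC Z) (FC X) (torsion_cycle (A X)) -(torsion_cycle Z X); ring.
Qed.

(** Since [D F = 0], the derivative of F by [Dg] is F contracted with the
    difference [D - Dg], which is T / 2. *)
Lemma levi_civita_deriv_torsion X Y Z : is_levi_civita g Dg ->
  cov_deriv02 Dg F X Y Z *+ 2 = - T X (A Y) Z - T X Y (A Z).
Proof.
move=> lc; rewrite (skewT X (A Y)) opprK.
rewrite /cov_deriv02 (parallel02E _ _ _ pF).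
rewrite !(FC Y) !FA !endo_skew_adjoint !(skew_torsion_contorsion _ _ _ lc).
rewrite -{2}(half_double (T X Z (A Y))) -{2}(half_double (T X Y (A Z))).
rewrite -!scalerMnr; ring.
Qed.

(** Differentiating [F = g(A, -)] with F and g parallel shows that A commutes
    with D up to a vector orthogonal to everything. *)
Lemma parallel_endo X Y : nondegenerate02 g -> D X (A Y) = A (D X Y).
Proof.
move=> nd; apply: (nondegenerate02_inj tg nd) => Z.
have := parallel02E X Y Z pF; rewrite !FA (parallel02E _ _ _ pg).
by move/addIr.
Qed.

(** Since A is parallel, the covariant derivatives in N cancel and N is built
    from the torsion alone. *)
Lemma nijenhuis_torsion X Y Z : (forall U W, D U (A W) = A (D U W)) ->
  lower g (nijenhuis A) X Y Z =
    - T (A X) (A Y) Z - T (A X) Y (A Z) - T X (A Y) (A Z) - T X Y (A (A Z)).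
Proof.
move=> DA; rewrite /lower /nijenhuis /torsion !(tensor02El tg).
rewrite !DA !endo_skew_adjoint; ring.
Qed.

End SkewTorsion.

(** * Connections preserving a generalized Riemannian metric *)

Theorem theorem2p4 (R : realType) (n : nat) (M : manifold R n)
  (G : vector_field M -> vector_field M -> smooth_fun M)
  (A : vector_field M -> vector_field M)
  (Dg D : vector_field M -> vector_field M -> vector_field M) :
  let g := sym_part G in
  let F := skew_part G in
  let N := lower g (nijenhuis A) in
  let T := lower g (torsion D) in
  let dF := ext_deriv2 F in
  is_tensor02 G ->
  nondegenerate02 g ->
  is_tensor11 A ->
  (forall X Y, F X Y = g (A X) Y) ->
  is_levi_civita g Dg ->
  is_connection D ->
  parallel02 D G ->
  totally_skew_torsion g D ->
  [/\ forall X Y Z,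
        N X Y (A Z) + N X Z (A Y) = dF X Y (A (A Z)) + dF X Z (A (A Y)),
      forall X Y Z, T (A X) (A Y) Z = - N X Y Z + dF X Y (A Z),
      forall X Y Z, T (A X) Y Z = cov_deriv02 Dg F X Y Z *+ 2 - dF X Y Z,
      (forall X Y Z, g (D X Y) Z = g (Dg X Y) Z + (2^-1 : R) *: T X Y Z) /\
      (forall D' : vector_field M -> vector_field M -> vector_field M,
         is_connection D' ->
         (forall X Y Z, g (D' X Y) Z = g (Dg X Y) Z + (2^-1 : R) *: T X Y Z) ->
         forall X Y, D' X Y = D X Y)
    & (forall X Y Z, dF X Y Z = 0) ->
      [/\ forall X Y Z, N X Y (A Z) + N X Z (A Y) = 0,
          forall X Y Z, T (A X) (A Y) Z = - N X Y Z
        & forall X Y Z, T (A X) Y Z = cov_deriv02 Dg F X Y Z *+ 2]].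
Proof.
move=> g F N T dF tG nd _ FA lc _ pG skewT.
have tg : is_tensor02 g by exact: sym_part_tensor.
have gC : forall X Y, g X Y = g Y X by exact: sym_partC.
have FC : forall X Y, F X Y = - F Y X by exact: skew_partC.
have pg : parallel02 D g by exact: parallel_sym_part.
have pF : parallel02 D F by exact: parallel_skew_part.
have DA X Y : D X (A Y) = A (D X Y) by exact: (parallel_endo tg pg FA pF).
have dFT := ext_deriv2_torsion tg gC skewT FC FA pF.
have NT X Y Z := nijenhuis_torsion tg gC FC FA X Y Z DA.
have TAA X Y Z : T (A X) (A Y) Z = - N X Y Z + dF X Y (A Z).
  by rewrite /N NT /dF dFT; ring.
have TA X Y Z : T (A X) Y Z = cov_deriv02 Dg F X Y Z *+ 2 - dF X Y Z.
  rewrite (levi_civita_deriv_torsion tg gC pg skewT FC FA pF _ _ _ lc).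
  by rewrite /dF dFT; ring.
have Ncond X Y Z :
    N X Y (A Z) + N X Z (A Y) = dF X Y (A (A Z)) + dF X Z (A (A Y)).
  (* T(AX,AY,AZ) is known twice: directly, and as - T(AX,AZ,AY). *)
  have := skewT (A X) (A Y) (A Z); rewrite -/T !TAA => e.
  apply/eqP; rewrite -subr_eq0 -oppr_eq0; apply/eqP.
  rewrite -(subrr (- N X Y (A Z) + dF X Y (A (A Z)))) {2}e; ring.
have Ddef X Y Z : g (D X Y) Z = g (Dg X Y) Z + (2^-1 : R) *: T X Y Z.
  exact: (skew_torsion_contorsion tg gC pg skewT _ _ _ lc).
split=> //.
- split=> // D' _ D'def X Y; apply: (nondegenerate02_inj tg nd) => Z.
  by rewrite D'def Ddef.
- move=> dF0; split=> X Y Z.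
  + by rewrite Ncond !dF0 addr0.
  + by rewrite TAA dF0 addr0.
  + by rewrite TA dF0 subr0.
Qed.
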